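(* Let $B=(b_{ij})_{1\le i,j\le 2n}$ be a $p$-antisymmetric matrix, that is, $b_{ii}=0$ for all $i$ and $b_{ji}=-p_{ij}b_{ij}$ for $i<j$, with (noncommutative) entries that commute with the entries of a $(p,u)$-matrix $T=(t_{ij})_{1\le i,j\le 2n}$. Let $C=T^tBT=(c_{ij})$, i.e. $c_{ij}=\sum_{k,l}t_{ki}b_{kl}t_{lj}$. Then $$c_{ji}=-p_{ij}c_{ij},\qquad i<j,$$ and $$\mathrm{Pf}_q(C)={\det}_q(T)\,\mathrm{Pf}_q(B).$$
   Context: Parameters: $u$, $p_{ij}$, $q_{ij}$ ($1\le i<j\le 2n$) are complex numbers with $p_{ij}q_{ij}=u^2$ for $i<j$, $u^2\neq-1$. All entries lie in a unital associative $\mathbb C$-algebra. A $(p,u)$-matrix $T=(t_{ij})_{1\le i,j\le 2n}$ is a matrix whose entries satisfy the defining relations of $\mathrm{M}_{p,u}(2n)$: for $i<j$, $k<l$ (first relation for all $i$, second for all $k$), $t_{ik}t_{il}=q_{kl}t_{il}t_{ik}$; $t_{ik}t_{jk}=p_{ij}t_{jk}t_{ik}$; $q_{kl}t_{il}t_{jk}=p_{ij}t_{jk}t_{il}$; $q_{kl}^{-1}t_{ik}t_{jl}-q_{ij}^{-1}t_{jl}t_{ik}=(1-u^{-2})t_{il}t_{jk}$. For a permutation $\sigma$ put $(-q)_\sigma=(-1)^{l(\sigma)}\prod_{i<j,\ \sigma_i>\sigma_j}q_{\sigma_j\sigma_i}$, $l(\sigma)$ being the number of inversions. Then ${\det}_q(T)=\sum_{\sigma\in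 S_{2n}}(-q)_\sigma t_{1,\sigma_1}\cdots t_{2n,\sigma_{2n}}$. The multiparameter quantum Pfaffian of a $2n\times2n$ $p$-antisymmetric matrix $B$ is $$\mathrm{Pf}_q(B)=\sum_{\sigma\in\Pi}(-q)_\sigma b_{\sigma(1)\sigma(2)}b_{\sigma(3)\sigma(4)}\cdots b_{\sigma(2n-1)\sigma(2n)},$$ where $\Pi$ is the set of $\sigma\in S_{2n}$ with $\sigma(2i-1)<\sigma(2i)$ for $i=1,\dots,n$. *)

(* Defs.v *)
From HB Require Import structures.
From mathcomp Require Import all_boot all_order all_algebra all_fingroup.
From mathcomp Require Import reals complex.

Set Implicit Arguments.
Unset Strict Implicit.
Unset Printing Implicit Defensive.

Import GRing.Theory.
Local Open Scope ring_scope.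

(* The parameters p_ij, q_ij are total functions of (i, j), but only their
   values at i < j are ever used. All indices are 0-based. *)

Definition inversions N (s : 'S_N) : {set 'I_N * 'I_N} :=
  [set ij : 'I_N * 'I_N | (ij.1 < ij.2)%N && (s ij.2 < s ij.1)%N].

(* (-q)_s *)
Definition qsign (K : comNzRingType) N (q : 'I_N -> 'I_N -> K) (s : 'S_N) : K :=
  (-1) ^+ #|inversions s| * \prod_(ij in inversions s) q (s ij.2) (s ij.1).

Section Multiparameter.

Variables (K : fieldType) (A : algType K) (N : nat).
Variables (p q : 'I_N -> 'I_N -> K).

(* The defining relations of M_{p,u}(N). *)
Record is_pu_matrix (u : K) (T : 'M[A]_N) : Prop := IsPuMatrix {
  pu_row : forall i k l : 'I_N, (k < l)%N ->
    T i k * T i l = q k l *: (T i l * T i k);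
  pu_col : forall i j k : 'I_N, (i < j)%N ->
    T i k * T j k = p i j *: (T j k * T i k);
  pu_anti : forall i j k l : 'I_N, (i < j)%N -> (k < l)%N ->
    q k l *: (T i l * T j k) = p i j *: (T j k * T i l);
  pu_diag : forall i j k l : 'I_N, (i < j)%N -> (k < l)%N ->
    (q k l)^-1 *: (T i k * T j l) - (q i j)^-1 *: (T j l * T i k)
      = (1 - u ^- 2) *: (T i l * T j k)
}.

Definition p_antisymmetric (B : 'M[A]_N) : Prop :=
  (forall i, B i i = 0) /\
  (forall i j : 'I_N, (i < j)%N -> B j i = - (p i j *: B i j)).

(* The product over 'I_N is taken in increasing order of the row index. *)
Definition qdet (T : 'M[A]_N) : A :=
  \sum_(s : 'S_N) qsign q s *: \prod_(i < N) T i (s i).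

End Multiparameter.

(* The 0-based positions 2i and 2i+1 of the i-th pair. *)
Definition pair_fst n (i : 'I_n) : 'I_n.*2 :=
  Ordinal (etrans (ltn_double i n) (ltn_ord i)).

Definition pair_snd n (i : 'I_n) : 'I_n.*2 :=
  Ordinal (etrans (ltn_Sdouble i n) (ltn_ord i)).

(* The index set Pi: the pairs are increasing, but are not sorted among
   themselves. *)
Definition pf_perms n : {set 'S_n.*2} :=
  [set s : 'S_n.*2 | [forall i : 'I_n, (s (pair_fst i) < s (pair_snd i))%N]].

Definition qPf (K : fieldType) (A : algType K) n
    (q : 'I_n.*2 -> 'I_n.*2 -> K) (B : 'M[A]_n.*2) : A :=
  \sum_(s in pf_perms n)
    qsign q s *: \prod_(i < n) B (s (pair_fst i)) (s (pair_snd i)).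

(* Main.v *)
(* In the quantum Grassmann algebra, generated by x_k with x_k^2 = 0 and
   x_l x_k = - q_kl x_k x_l for k < l, set omega_i = sum_k t_ik x_k. The defining
   relations of a (p,u)-matrix imply that the omega_i satisfy the same
   relations as the x_k and that omega_1 ... omega_N = det_q(T) x_1 ... x_N.
   For any such family y, the n-th power of sum_(i<j) b_ij y_i y_j is
   Pf_q(B) y_1 ... y_2n. Since the quadratic form of C in the x_k is the
   quadratic form of B in the omega_i, comparing n-th powers yields
   Pf_q(C) = Pf_q(B) det_q(T), and the two factors commute. *)

Require Import Defs.
From HB Require Import structures.
From mathcomp Require Import all_boot all_order all_algebra all_fingroup.
From mathcomp Require Import reals complex.
From mathcomp Require Import ring.

Import GRing.Theory.
Set Implicit Arguments.
Unset Strict Implicit.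
Unset Printing Implicit Defensive.

Local Open Scope ring_scope.
Local Open Scope complex_scope.

(** * Signs of words and of permutations *)

Lemma enum_ord_sorted N : sorted (fun i j : 'I_N => (i < j)%N) (enum 'I_N).
Proof.
have := iota_ltn_sorted 0 N; by rewrite -val_enum_ord sorted_map.
Qed.

(* [big_enum] needs commutativity, hence this variant. *)
Lemma index_enum_ord N : index_enum 'I_N = enum 'I_N.
Proof. by rewrite enumT [index_enum _]unlock. Qed.

(* The factor picked up by sorting w when letters obey y_a y_b = - q_ba y_b y_a
   for b < a. *)
Fixpoint word_sign {K : comNzRingType} {N} (q : 'I_N -> 'I_N -> K)
    (w : seq 'I_N) : K :=
  if w is a :: w' then \prod_(b <- w' | (b < a)%N) (- q b a) * word_sign q w'
  else 1.

(** As [l] is increasing, the letters that follow [i] in it are exactly the larger ones, so the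
    sorting factor runs over inversions of [s]. *)
Lemma word_sign_map (K : comNzRingType) N (q : 'I_N -> 'I_N -> K)
    (s : 'I_N -> 'I_N) (l : seq 'I_N) :
  sorted (fun i j : 'I_N => (i < j)%N) l ->
  word_sign q (map s l) =
  \prod_(i <- l) \prod_(j <- l | (i < j)%N && (s j < s i)%N) (- q (s j) (s i)).
Proof.
elim: l => [|a l IHl] /=; first by rewrite big_nil.
move=> sl; have /allP alt := order_path_min (fun y x z : 'I_N => @ltn_trans y x z) sl.
rewrite IHl ?(path_sorted sl) // big_cons big_map; congr (_ * _).
  rewrite big_cons ltnn /= big_seq_cond [RHS]big_seq_cond.
  by apply: eq_bigl => j; case: (boolP (j \in l)) => //= /alt ->.
rewrite big_seq [RHS]big_seq; apply: eq_bigr => i /alt ai.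
by rewrite big_cons ltnNge (ltnW ai).
Qed.

Lemma word_sign_perm (K : comNzRingType) N (q : 'I_N -> 'I_N -> K) (s : 'S_N) :
  word_sign q (map s (enum 'I_N)) = qsign q s.
Proof.
rewrite word_sign_map ?enum_ord_sorted // /qsign -prodrN big_enum.
under eq_bigr do rewrite big_enum_cond.
by rewrite pair_big_dep /=; apply: eq_bigl => -[i j]; rewrite inE.
Qed.

(** * Reordering products in a family with quantum Grassmann relations *)

Section GrassmannRelations.

Variables (K : comNzRingType) (N : nat) (q : 'I_N -> 'I_N -> K).
Variables (E : pzRingType) (phi : {rmorphism K -> E}).
Hypothesis phi_central : forall c x, phi c * x = x * phi c.

(** Scalars act through a central morphism [phi], so that [E] can be a matrix ring over a
    noncommutative algebra and [y] either the generators or the forms omega_i. *)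
Definition grassmann (y : 'I_N -> E) : Prop :=
  (forall k, y k * y k = 0) /\
  (forall k l : 'I_N, (k < l)%N -> y l * y k = phi (- q k l) * (y k * y l)).

Variable y : 'I_N -> E.
Hypothesis y_grassmann : grassmann y.

(** The factor [y a] travels right to its sorted place: each smaller letter [b] that it passes costs
    [- q b a], and meeting another [y a] gives 0. *)
Lemma grassmann_insert (l w : seq 'I_N) (a : 'I_N) :
    sorted (fun i j : 'I_N => (i < j)%N) l -> a \in l ->
  y a * \prod_(i <- l | i \in w) y i =
  if a \in w then 0 else
    phi (\prod_(b <- l | (b \in w) && (b < a)%N) (- q b a)) *
      \prod_(i <- l | i \in a :: w) y i.
Proof.
have [y2 yC] := y_grassmann.
elim: l => [|b l IHl] //= sl.
have /allP blt := order_path_min (fun y x z : 'I_N => @ltn_trans y x z) sl.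
rewrite [a \in _]inE; case: eqVneq => [-> _|neq_ab /= al].
  rewrite !big_cons !inE eqxx /= ltnn andbF.
  case: ifP => [_|bNw]; first by rewrite mulrA y2 mul0r.
  rewrite [X in phi X](_ : _ = 1) ?rmorph1 ?mul1r; last first.
    rewrite big_seq_cond big_pred0 // => i; case: (boolP (i \in l)) => //= /blt bi.
    by rewrite ltnNge (ltnW bi) andbF.
  congr (_ * _); rewrite big_seq_cond [RHS]big_seq_cond; apply: eq_bigl => i.
  rewrite inE; case: (boolP (i \in l)) => //= /blt bi.
  by rewrite -val_eqE /= gtn_eqF.
have ba : (b < a)%N := blt _ al.
have {IHl} := IHl (path_sorted sl) al.
rewrite !big_cons inE eq_sym (negPf neq_ab) /= ba andbT.
case: (b \in w) => // IHl.
rewrite mulrA yC // -!mulrA IHl; case: (a \in w); first by rewrite !mulr0.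
by rewrite rmorphM -!mulrA; congr (_ * _); rewrite !mulrA phi_central.
Qed.

Lemma grassmann_word (w : seq 'I_N) :
  \prod_(a <- w) y a =
  if uniq w then phi (word_sign q w) * \prod_(i <- enum 'I_N | i \in w) y i else 0.
Proof.
elim: w => [|a w IHw] /=.
  by rewrite big_nil rmorph1 mul1r big_pred0_eq.
rewrite big_cons IHw; case: (boolP (uniq w)) => [uw|_]; last by rewrite mulr0 andbF.
rewrite andbT mulrA -phi_central -mulrA grassmann_insert ?mem_enum ?enum_ord_sorted //.
case: ifP => _; first by rewrite mulr0.
rewrite mulrA -rmorphM /= mulrC; congr (phi (_ * _) * _).
(* Both products range over the letters of [w] below [a], once in increasing order and once in word
   order; they agree because [w] has no repetition. *)
rewrite big_enum_cond big_mkcond [RHS]big_mkcond (big_uniq _ uw) [RHS]big_mkcond.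
by apply: eq_bigr => b _; case: (b \in w).
Qed.

Lemma grassmann_ffun (g : {ffun 'I_N -> 'I_N}) :
  ~~ injectiveb g -> \prod_i y (g i) = 0.
Proof.
move=> gNinj; have <- : \prod_(a <- map g (enum 'I_N)) y a = \prod_i y (g i).
  by rewrite big_map index_enum_ord.
rewrite grassmann_word.
by rewrite -[uniq _]/(injectiveb g) (negPf gNinj).
Qed.

Lemma grassmann_perm (s : 'S_N) :
  \prod_i y (s i) = phi (qsign q s) * \prod_i y i.
Proof.
have <- : \prod_(a <- map s (enum 'I_N)) y a = \prod_i y (s i).
  by rewrite big_map index_enum_ord.
rewrite grassmann_word map_inj_uniq ?enum_uniq; last exact: perm_inj.
rewrite word_sign_perm index_enum_ord; congr (_ * _); apply: eq_bigl => k.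
by rewrite -[k](permKV s) map_f ?mem_enum.
Qed.

End GrassmannRelations.

(** * Reindexing by permutations and by consecutive pairs *)

Lemma sum_ffun_perm (V : nmodType) N (P : pred {ffun 'I_N -> 'I_N})
    (F : {ffun 'I_N -> 'I_N} -> V) :
  (forall g : {ffun 'I_N -> 'I_N}, ~~ injectiveb g -> F g = 0) ->
  \sum_(g | P g) F g =
  \sum_(s : 'S_N | P [ffun k => s k]) F [ffun k => s k].
Proof.
move=> F0; rewrite (bigID (fun g : {ffun _} => injectiveb g)) /= addrC big1 ?add0r.
  (* The default [1%g] of [insubd] is never reached, since only injective functions remain. *)
  rewrite (reindex_onto (fun s : 'S_N => [ffun k => s k])
             (fun g => insubd (1%g : 'S_N) g)) /= => [|g /andP[_ inj_g]].
    apply: eq_bigl => s; rewrite -andbA; case: (P _) => //=; apply/andP; split.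
      by apply/injectiveP => i j; rewrite !ffunE => /perm_inj.
    apply/eqP/permP => k; rewrite -pvalE insubdK ?ffunE //.
    by apply/injectiveP => i j; rewrite !ffunE => /perm_inj.
  by apply/ffunP => k; rewrite ffunE -pvalE insubdK.
by move=> g /andP[_ /F0].
Qed.

Lemma prod_pairs (E : pzRingType) n (F : 'I_n.*2 -> E) :
  \prod_i F i = \prod_(k < n) (F (pair_fst k) * F (pair_snd k)).
Proof.
elim: n F => [|n IHn] F; first by rewrite !big_ord0.
rewrite [RHS]big_ord_recl -mulrA !(@big_ord_recl _ _ _ n.*2.+1, @big_ord_recl _ _ _ n.*2) IHn.
congr (F _ * (F _ * _)); try exact: val_inj.
by apply: eq_bigr => k _; congr (F _ * F _); apply: val_inj.
Qed.

Lemma half_pair_proof n (j : 'I_n.*2) : (j./2 < n)%N.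
Proof. by rewrite -ltn_double (leq_ltn_trans _ (ltn_ord j)) // -[leqRHS]odd_double_half leq_addl. Qed.

Definition half_pair n (j : 'I_n.*2) : 'I_n := Ordinal (half_pair_proof j).

Lemma pairs_bij n (I : finType) :
  bijective (fun g : {ffun 'I_n.*2 -> I} =>
    [ffun k : 'I_n => (g (pair_fst k), g (pair_snd k))]).
Proof.
exists (fun f : {ffun 'I_n -> I * I} =>
  [ffun j : 'I_n.*2 => if odd j then (f (half_pair j)).2 else (f (half_pair j)).1]).
  move=> g; apply/ffunP => j; rewrite !ffunE /=.
  by case: (boolP (odd j)) => oj; congr (g _); apply: val_inj;
    rewrite /= -[RHS]odd_double_half ?oj // (negPf oj).
move=> f; apply/ffunP => k; rewrite !ffunE /= odd_double /=.
have -> : half_pair (pair_fst k) = k by apply: val_inj; rewrite /= doubleK.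
have -> : half_pair (pair_snd k) = k by apply: val_inj; rewrite /= uphalf_double.
by case: (f k).
Qed.

(** * The determinant and the Pfaffian as coefficients of the top monomial *)

Section Expansion.

Variables (K : fieldType) (A : algType K) (E : pzRingType).
Variable iota : {rmorphism A -> E}.

Let phi : {rmorphism K -> E} := iota \o in_alg A.

Hypothesis phi_central : forall c x, phi c * x = x * phi c.

Lemma iotaZ c a : iota (c *: a) = phi c * iota a.
Proof. by rewrite /phi /= -rmorphM mulr_algl. Qed.

(** Distributing the product gives one term per choice function; repeated indices kill a term, and
    reordering the [x] along a permutation produces [qsign]. *)
Lemma prod_linear_forms N (q : 'I_N -> 'I_N -> K) (x : 'I_N -> E) (T : 'M[A]_N) :
    grassmann q phi x ->
    (forall a k, iota a * x k = x k * iota a) ->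
  \prod_i \sum_k iota (T i k) * x k = iota (qdet q T) * \prod_i x i.
Proof.
move=> x_gr xC; rewrite bigA_distr_bigA /= (sum_ffun_perm xpredT).
  rewrite /qdet rmorph_sum mulr_suml; apply: eq_bigr => s _.
  rewrite prodrM_comm => [|i j _ _]; last by rewrite /GRing.comm xC.
  have -> : \prod_i x ([ffun k => s k] i) = phi (qsign q s) * \prod_i x i.
    by under eq_bigr do rewrite ffunE; apply: (grassmann_perm phi_central x_gr).
  rewrite mulrA -phi_central iotaZ rmorph_prod.
  by under eq_bigr do rewrite ffunE.
move=> g gNinj; rewrite prodrM_comm => [|i j _ _]; last by rewrite /GRing.comm xC.
by rewrite (grassmann_ffun phi_central x_gr) ?mulr0.
Qed.

(** The power is written as a constant product so that it distributes over choices of [n] pairs.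
    Laid end to end, the pairs form a function on 2n positions, and only permutations survive. *)
Lemma pfaffian_power n (q : 'I_n.*2 -> 'I_n.*2 -> K) (y : 'I_n.*2 -> E)
    (B : 'M[A]_n.*2) :
    grassmann q phi y ->
    (forall i j k, iota (B i j) * y k = y k * iota (B i j)) ->
  \prod_(k < n) \sum_(ij : 'I_n.*2 * 'I_n.*2 | (ij.1 < ij.2)%N)
      iota (B ij.1 ij.2) * (y ij.1 * y ij.2) =
  iota (qPf q B) * \prod_i y i.
Proof.
move=> y_gr yC; rewrite bigA_distr_big /=.
rewrite (reindex _ (onW_bij _ (pairs_bij _ _))) /=.
have split_prod (g : {ffun 'I_n.*2 -> 'I_n.*2}) :
    let f := [ffun k : 'I_n => (g (pair_fst k), g (pair_snd k))] in
    \prod_(k < n) (iota (B (f k).1 (f k).2) * (y (f k).1 * y (f k).2)) =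
    iota (\prod_(k < n) B (g (pair_fst k)) (g (pair_snd k))) * \prod_j y (g j).
  rewrite /=; under eq_bigr do rewrite ffunE /=.
  rewrite prodrM_comm => [|i j _ _]; last first.
    by rewrite /GRing.comm mulrA yC -mulrA yC mulrA.
  by rewrite rmorph_prod [in RHS]prod_pairs.
under eq_bigr do rewrite split_prod.
rewrite sum_ffun_perm => [|g gNinj]; last by rewrite (grassmann_ffun phi_central y_gr) ?mulr0.
rewrite /qPf rmorph_sum mulr_suml; apply: eq_big => [s|s _].
  (* All chosen pairs are increasing exactly when [s] lies in [pf_perms]. *)
  rewrite [RHS]inE; apply/ffun_onP/forallP => [|] s_lt k.
    by have := s_lt k; rewrite !ffunE.
  by rewrite !ffunE; apply: s_lt.
have -> : \prod_j y ([ffun k => s k] j) = phi (qsign q s) * \prod_i y i.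
  by under eq_bigr do rewrite ffunE; apply: (grassmann_perm phi_central y_gr).
rewrite mulrA -phi_central iotaZ; congr (_ * iota _ * _).
by apply: eq_bigr => k _; rewrite !ffunE.
Qed.

End Expansion.

Lemma sum_ordered_pairs (V : nmodType) N (F : 'I_N -> 'I_N -> V) :
  (forall i, F i i = 0) ->
  \sum_i \sum_j F i j =
  \sum_(ij : 'I_N * 'I_N | (ij.1 < ij.2)%N) (F ij.1 ij.2 + F ij.2 ij.1).
Proof.
move=> F0; rewrite pair_bigA /= (bigID (fun ij : 'I_N * 'I_N => (ij.1 < ij.2)%N)) /=.
rewrite big_split /=; congr (_ + _).
rewrite (bigID (fun ij : 'I_N * 'I_N => ij.1 == ij.2)) /= big1 ?add0r => [|[i j]]; last first.
  by case/andP => _ /eqP /= ->.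
have swapI : involutive (fun ij : 'I_N * 'I_N => (ij.2, ij.1)) by case.
rewrite (reindex_inj (inv_inj swapI)) /=; apply: eq_bigl => -[i j] /=.
by rewrite -leqNgt ltn_neqAle -val_eqE eq_sym andbC.
Qed.

(** * A matrix model of the quantum Grassmann algebra *)

Section GrassmannAlgebra.

Variables (K : comNzRingType) (N : nat) (q : 'I_N -> 'I_N -> K).

Definition basis_vector (J : {set 'I_N}) : 'cV[K]_#|{set 'I_N}| :=
  delta_mx (enum_rank J) 0.

(** This is x_k times the increasing monomial on [J]; the scalar comes from moving x_k past the
    smaller letters. *)
Definition wedge (k : 'I_N) (J : {set 'I_N}) : 'cV[K]_#|{set 'I_N}| :=
  if k \in J then 0
  else \prod_(b in J | (b < k)%N) (- q b k) *: basis_vector (k |: J).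

(* Left multiplication by the k-th generator of the quantum Grassmann algebra,
   in the basis of increasing monomials. *)
Definition generator (k : 'I_N) : 'M[K]_#|{set 'I_N}| :=
  \matrix_(i, j) wedge k (enum_val j) i 0.

Lemma mul_generator k J : generator k *m basis_vector J = wedge k J.
Proof. by rewrite -colE; apply/colP => i; rewrite !mxE enum_rankK. Qed.

Lemma eq_on_basis (X Y : 'M[K]_#|{set 'I_N}|) :
  (forall J, X *m basis_vector J = Y *m basis_vector J) -> X = Y.
Proof.
move=> eqXY; apply/matrixP => i j.
by have /colP/(_ i) := eqXY (enum_val j); rewrite -!colE enum_valK !mxE.
Qed.

Lemma generator_sqr k : generator k *m generator k = 0.
Proof.
apply: eq_on_basis => J; rewrite mul0mx -mulmxA mul_generator /wedge.
case: ifP => _; first by rewrite mulmx0.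
by rewrite -scalemxAr mul_generator /wedge setU11 scaler0.
Qed.

(** Both sides vanish on [J] if it contains [k] or [l]. Otherwise, inserting [l] after [k] crosses
    one letter more than inserting it first, namely [k], whereas inserting [k] never crosses the
    larger [l]. *)
Lemma generatorC (k l : 'I_N) : (k < l)%N ->
  generator l *m generator k = - q k l *: (generator k *m generator l).
Proof.
move=> kl; have neq_kl : k != l by rewrite -val_eqE /= ltn_eqF.
apply: eq_on_basis => J.
rewrite -scalemxAl -!mulmxA !mul_generator /wedge.
case: (boolP (k \in J)) => kJ; case: (boolP (l \in J)) => lJ.
- by rewrite !mulmx0 scaler0.
- by rewrite mulmx0 -scalemxAr mul_generator /wedge !inE kJ orbT !scaler0.
- by rewrite mulmx0 -scalemxAr mul_generator /wedge !inE lJ orbT !scaler0.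
rewrite -!scalemxAr !mul_generator /wedge !inE (negPf kJ) (negPf lJ) !orbF.
rewrite eq_sym (negPf neq_kl) !scalerA setUCA.
congr (_ *: _).
rewrite [X in _ * X = _](bigD1 k) /= ?setU11 // mulrCA -mulrA; congr (_ * _).
rewrite mulrC; congr (_ * _); apply: eq_bigl => b; rewrite !inE.
  by case: eqVneq => [->|] /=; rewrite ?(negPf kJ) ?andbF ?andbT.
by case: eqVneq => [->|] //=; rewrite (negPf lJ) ltnNge (ltnW kl).
Qed.

(** The generators act from the largest index down, so each enters in front of all letters present
    and no scalar arises. *)
Lemma top_product : (\prod_i generator i) *m basis_vector set0 = basis_vector setT.
Proof.
suff top_seq (l : seq 'I_N) : sorted (fun i j : 'I_N => (i < j)%N) l ->
    (\prod_(i <- l) generator i) *m basis_vector set0 = basis_vector [set i in l].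
  rewrite index_enum_ord top_seq ?enum_ord_sorted //; congr basis_vector.
  by apply/setP => i; rewrite !inE mem_enum.
elim: l => [|a l IHl] /= sl.
  by rewrite big_nil mul1mx; congr basis_vector; apply/setP => i; rewrite !inE.
have /allP alt := order_path_min (fun y x z : 'I_N => @ltn_trans y x z) sl.
rewrite big_cons -mulmxA IHl ?(path_sorted sl) // mul_generator /wedge inE.
case: ifP => [/alt|_]; first by rewrite ltnn.
rewrite big_pred0 ?scale1r => [|i]; last first.
  by rewrite inE; case: (boolP (i \in l)) => //= /alt ai; rewrite ltnNge (ltnW ai).
by congr basis_vector; apply/setP => i; rewrite !inE.
Qed.

End GrassmannAlgebra.

(** * The linear forms omega_i and the congruence by [T] *)

Section Pfaffian.

Variables (K : fieldType) (A : algType K) (N : nat).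
Variables (p q : 'I_N -> 'I_N -> K) (u : K).

(** Matrices over [A] play the tensor product of [A] with the Grassmann algebra: [A] enters as
    scalar matrices, which commute with the [x k] because these have entries from [K]. *)
Let iota : {rmorphism A -> 'M[A]_#|{set 'I_N}|} := scalar_mx.
Let phi : {rmorphism K -> 'M[A]_#|{set 'I_N}|} := iota \o in_alg A.
Let x (k : 'I_N) : 'M[A]_#|{set 'I_N}| := map_mx (in_alg A) (generator q k).

Lemma scalar_mx_map_comm a (X : 'M[K]_#|{set 'I_N}|) :
  iota a * map_mx (in_alg A) X = map_mx (in_alg A) X * iota a.
Proof.
rewrite /iota /= -[X in _ = X]/(_ *m _) -[LHS]/(_ *m _).
rewrite -diag_const_mx mul_diag_mx mul_mx_diag; apply/matrixP => i j.
by rewrite !mxE mulr_algl mulr_algr.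
Qed.

Lemma phi_central c X : phi c * X = X * phi c.
Proof.
rewrite /phi /iota /= -[X in _ = X]/(_ *m _) -[LHS]/(_ *m _).
rewrite -diag_const_mx mul_diag_mx mul_mx_diag; apply/matrixP => i j.
by rewrite !mxE mulr_algl mulr_algr.
Qed.

Lemma x_grassmann : grassmann q phi x.
Proof.
split=> [k|k l kl]; rewrite /x -[LHS]/(_ *m _) -map_mxM.
  by rewrite generator_sqr map_mx0.
by rewrite generatorC // map_mxZ map_mxM -mul_scalar_mx.
Qed.

(** Applied to the empty monomial, the top product gives the basis vector of [setT], whose
    coordinate reads off the coefficient. *)
Lemma iota_top_inj a b : iota a * \prod_i x i = iota b * \prod_i x i -> a = b.
Proof.
rewrite /x -rmorph_prod /= => /(congr1 (mulmx^~ (map_mx (in_alg A) (basis_vector K set0)))).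
rewrite -!mulmxA -!map_mxM top_product !mul_scalar_mx.
by move=> /colP/(_ (enum_rank setT)); rewrite !mxE !eqxx /= scale1r !mulr1.
Qed.

Variable T : 'M[A]_N.
Hypothesis u_neq0 : u != 0.
Hypothesis pq_u2 : forall i j : 'I_N, (i < j)%N -> p i j * q i j = u ^+ 2.
Hypothesis T_pu : is_pu_matrix p q u T.

Let omega (i : 'I_N) : 'M[A]_#|{set 'I_N}| := \sum_k iota (T i k) * x k.

Lemma q_neq0 (i j : 'I_N) : (i < j)%N -> q i j != 0.
Proof.
by move=> /pq_u2 pq; apply: contraNneq u_neq0 => q0; rewrite -sqrf_eq0 -pq q0 mulr0.
Qed.

Lemma p_neq0 (i j : 'I_N) : (i < j)%N -> p i j != 0.
Proof.
by move=> /pq_u2 pq; apply: contraNneq u_neq0 => p0; rewrite -sqrf_eq0 -pq p0 mul0r.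
Qed.

Lemma pu_diag_reverse (i j k l : 'I_N) : (i < j)%N -> (k < l)%N ->
  T j l * T i k =
  (q i j / q k l) *: (T i k * T j l) - (q i j * (1 - u ^- 2)) *: (T i l * T j k).
Proof.
move=> ij kl; rewrite -!scalerA -(pu_diag T_pu ij kl) scalerBr opprB addrCA subrr addr0.
by rewrite scalerA mulfV ?q_neq0 // scale1r.
Qed.

(** The relations reduce both sides to [T i k * T j l] and [T i l * T j k]; the coefficients match
    because p_ij q_ij = u^2. This yields the exchange rule for the omega_i. *)
Lemma row_minor_swap (i j k l : 'I_N) : (i < j)%N -> (k < l)%N ->
  T j k * T i l - q k l *: (T j l * T i k) =
  - q i j *: (T i k * T j l - q k l *: (T i l * T j k)).
Proof.
move=> ij kl; have qij := q_neq0 ij; have qkl := q_neq0 kl; have pij := p_neq0 ij.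
have -> : T j k * T i l = (q k l / p i j) *: (T i l * T j k).
  by rewrite mulrC -scalerA (pu_anti T_pu ij kl) scalerA mulVf // scale1r.
rewrite (pu_diag_reverse ij kl) !scalerBr !scalerA opprB addrA -scalerDl addrC -!scaleNr.
by congr (_ *: _ + _ *: _); rewrite -?(pq_u2 ij); field;
  rewrite ?qij ?pij ?qkl.
Qed.

Lemma col_minor_swap (i j k l : 'I_N) : (i < j)%N -> (k < l)%N ->
  T i l * T j k - p i j *: (T j l * T i k) =
  - p k l *: (T i k * T j l - p i j *: (T j k * T i l)).
Proof.
move=> ij kl; have qij := q_neq0 ij; have qkl := q_neq0 kl; have pij := p_neq0 ij.
rewrite -(pu_anti T_pu ij kl) (pu_diag_reverse ij kl) !scalerBr !scalerA opprB addrA.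
rewrite -[X in X + _ - _]scale1r -scalerDl addrC -!scaleNr.
(* The products p_kl q_kl and p_ij q_ij are both u^2, which eliminates p_kl. *)
have pkl : p k l = p i j * q i j / q k l by rewrite (pq_u2 ij) -(pq_u2 kl) mulfK.
by congr (_ *: _ + _ *: _);
  rewrite pkl -?(pq_u2 ij); field; rewrite ?qij ?pij ?qkl.
Qed.

(** The coefficients are quantum 2x2 minors. The case [i = j] is included: there [pu_row] makes them
    vanish, whence omega_i^2 = 0. *)
Lemma omega_mul i j :
  omega i * omega j =
  \sum_(kl : 'I_N * 'I_N | (kl.1 < kl.2)%N)
    iota (T i kl.1 * T j kl.2 - q kl.1 kl.2 *: (T i kl.2 * T j kl.1)) *
      (x kl.1 * x kl.2).
Proof.
have [x2 xC] := x_grassmann.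
have termE k l : iota (T i k) * x k * (iota (T j l) * x l) =
    iota (T i k * T j l) * (x k * x l).
  by rewrite rmorphM -!mulrA; congr (_ * _); rewrite !mulrA scalar_mx_map_comm.
rewrite /omega mulr_suml.
under eq_bigr => k _ do (rewrite mulr_sumr; under eq_bigr => l _ do rewrite termE).
rewrite sum_ordered_pairs => [|k]; last by rewrite x2 mulr0.
apply: eq_bigr => -[k l] /= kl.
rewrite (xC _ _ kl) [X in _ + X = _]mulrA -mulrDl; congr (_ * _).
by rewrite -phi_central -(iotaZ iota) scaleNr -rmorphD.
Qed.

Lemma omega_grassmann : grassmann q phi omega.
Proof.
split=> [i|i j ij]; rewrite !omega_mul.
  apply: big1 => -[k l] /= kl.
  by rewrite (pu_row T_pu) // subrr rmorph0 mul0r.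
rewrite mulr_sumr; apply: eq_bigr => -[k l] /= kl.
by rewrite row_minor_swap // (iotaZ iota) -mulrA.
Qed.

Variable B : 'M[A]_N.
Hypothesis B_anti : p_antisymmetric p B.
Hypothesis BT_comm : forall i j k l : 'I_N, B i j * T k l = T k l * B i j.

Let C := T^T *m B *m T.

Lemma congruence_entry k l :
  C k l = \sum_(ij : 'I_N * 'I_N | (ij.1 < ij.2)%N)
    B ij.1 ij.2 * (T ij.1 k * T ij.2 l - p ij.1 ij.2 *: (T ij.2 k * T ij.1 l)).
Proof.
have [B0 BN] := B_anti.
have -> : C k l = \sum_i \sum_j B i j * (T i k * T j l).
  rewrite exchange_big mxE; apply: eq_bigr => j _; rewrite mxE mulr_suml.
  by apply: eq_bigr => i _; rewrite mxE mulrA BT_comm.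
rewrite sum_ordered_pairs => [|i]; last by rewrite B0 mul0r.
apply: eq_bigr => -[i j] /= ij.
by rewrite (BN _ _ ij) mulNr -scalerAl mulrBr -scalerAr.
Qed.

Lemma congruence_antisymmetric (i j : 'I_N) : (i < j)%N -> C j i = - (p i j *: C i j).
Proof.
move=> ij; rewrite !congruence_entry scaler_sumr -sumrN.
apply: eq_bigr => -[k l] /= kl; rewrite [p i j *: _]scalerAr -mulrN; congr (_ * _).
(* Here [k < l] index rows of [T] and [i < j] index columns. *)
by rewrite -[RHS]scaleNr (col_minor_swap kl ij).
Qed.

Lemma congruence_form :
  \sum_(kl : 'I_N * 'I_N | (kl.1 < kl.2)%N) iota (C kl.1 kl.2) * (x kl.1 * x kl.2) =
  \sum_(ij : 'I_N * 'I_N | (ij.1 < ij.2)%N)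
    iota (B ij.1 ij.2) * (omega ij.1 * omega ij.2).
Proof.
under eq_bigr do rewrite congruence_entry rmorph_sum mulr_suml.
rewrite exchange_big /=; apply: eq_bigr => -[i j] /= ij.
rewrite omega_mul mulr_sumr; apply: eq_bigr => -[k l] /= kl.
(* The minor in c_kl carries p_ij and the one in omega_i omega_j carries q_kl; [pu_anti] identifies
   the two. *)
by rewrite rmorphM -mulrA (pu_anti T_pu).
Qed.

Lemma omega_comm i j k : iota (B i j) * omega k = omega k * iota (B i j).
Proof.
rewrite /omega mulr_sumr mulr_suml; apply: eq_bigr => l _.
by rewrite mulrA -rmorphM BT_comm rmorphM -!mulrA scalar_mx_map_comm.
Qed.

End Pfaffian.

(** * Comparison of the top coefficients *)

Lemma qdet_qPf_comm (K : fieldType) (A : algType K) n (q : 'I_n.*2 -> 'I_n.*2 -> K)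
    (T B : 'M[A]_n.*2) :
  (forall i j k l, B i j * T k l = T k l * B i j) ->
  qPf q B * qdet q T = qdet q T * qPf q B.
Proof.
move=> BT_comm; apply/esym/commr_sum => s _; apply/commr_sym/commr_sum => t _.
rewrite /GRing.comm -!(scalerAl, scalerAr) scalerA mulrC -scalerA; do 2!congr (_ *: _).
apply: commr_prod => i _; apply/commr_sym/commr_prod => j _.
exact/esym/BT_comm.
Qed.

Lemma qPf_congruence (K : fieldType) (A : algType K) n (u : K)
    (p q : 'I_n.*2 -> 'I_n.*2 -> K) (T B : 'M[A]_n.*2) :
  u != 0 -> (forall i j : 'I_n.*2, (i < j)%N -> p i j * q i j = u ^+ 2) ->
  is_pu_matrix p q u T -> p_antisymmetric p B ->
  (forall i j k l, B i j * T k l = T k l * B i j) ->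
  qPf q (T^T *m B *m T) = qdet q T * qPf q B.
Proof.
(* The factors are swapped because the expansion in the omega_i puts the Pfaffian of [B] to the left
   of the determinant. *)
move=> u_neq0 pq_u2 T_pu B_anti BT_comm; rewrite -qdet_qPf_comm //.
apply: (@iota_top_inj _ _ _ q).
have phiC := @phi_central K A n.*2; have x_gr := @x_grassmann K A _ q.
rewrite -(pfaffian_power phiC x_gr) => [|i j k]; last exact: scalar_mx_map_comm.
rewrite (congruence_form T_pu B_anti BT_comm).
(* The same power is expanded again, now with the omega_i in place of the [x]; their product then
   supplies the determinant. *)
rewrite (pfaffian_power phiC (omega_grassmann u_neq0 pq_u2 T_pu)) => [|i j k]; last first.
  exact: omega_comm.
rewrite (prod_linear_forms phiC _ x_gr) ?mulrA ?rmorphM // => a k.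
exact: scalar_mx_map_comm.
Qed.

Theorem theorem5p3 (R : realType) (A : algType R[i]) (n : nat)
    (u : R[i]) (p q : 'I_n.*2 -> 'I_n.*2 -> R[i])
    (u_neq0 : u != 0) (u2_neqN1 : u ^+ 2 != -1)
    (pq_u2 : forall i j : 'I_n.*2, (i < j)%N -> p i j * q i j = u ^+ 2)
    (T B : 'M[A]_n.*2)
    (T_pu : is_pu_matrix p q u T)
    (B_anti : p_antisymmetric p B)
    (BT_comm : forall i j k l : 'I_n.*2, B i j * T k l = T k l * B i j) :
  let C := T^T *m B *m T in
  (forall i j : 'I_n.*2, (i < j)%N -> C j i = - (p i j *: C i j)) /\
  qPf q C = qdet q T * qPf q B.
Proof.
split; last exact: qPf_congruence u_neq0 pq_u2 T_pu B_anti BT_comm.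
move=> i j; exact: (congruence_antisymmetric u_neq0 pq_u2 T_pu B_anti BT_comm).
Qed.
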